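(* Let $\mathcal I$ be an ideal information model whose canonical semantic representative (semantic state set) is the finite knowledge base $S_O\subseteq\mathbb S_O$. Define the semantic atomicity $\mathsf A(\mathcal I):=|\mathrm{Atom}(S_O)|$, the maximum intrinsic derivation depth $\mathsf{D_d}(\mathcal I):=\max_{q\in S_O}\mathrm{Dd}(q\mid \mathrm{Atom}(S_O))$ (with $\max\varnothing:=0$), and for $q\in S_O$ the intrinsic and operational depths $n_{\mathrm{int}}(q):=\mathrm{Dd}(q\mid\mathrm{Atom}(S_O))$, $n_{\mathrm{op}}(q):=\mathrm{Dd}(q\mid S_O)$. Then: (i) $\mathsf A(\mathcal I)$ and $\mathsf{D_d}(\mathcal I)$ are uniquely determined by $S_O$ and the fixed canonical order; (ii) both are finite non-negative integers computable from $S_O$; (iii) for every $q\in S_O$, $n_{\mathrm{op}}(q)\le n_{\mathrm{int}}(q)\le \mathsf{D_d}(\mathcal I)$; (iv) $\mathsf{D_d}(\mathcal I)=0$ if and only if $\mathrm{Atom}(S_O)=S_O$.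
   Context: Fix a countable ambient semantic universe $\mathbb S_O$, whose elements are identified with ground atoms of a fixed inference fragment equipped with a fixed effective proof system $\mathsf{PS}$ (proof checking decidable). For $\Gamma\subseteq\mathbb S_O$, $\mathrm{Cn}(\Gamma)$ is the set of formulas derivable from $\Gamma$; it satisfies reflexivity ($\Gamma\subseteq\mathrm{Cn}(\Gamma)$), monotonicity ($\Gamma\subseteq\Gamma'\Rightarrow \mathrm{Cn}(\Gamma)\subseteq\mathrm{Cn}(\Gamma')$) and idempotence ($\mathrm{Cn}(\mathrm{Cn}(\Gamma))=\mathrm{Cn}(\Gamma)$). The immediate consequence operator is $T(\Gamma):=\Gamma\cup\{s\in\mathbb S_O: s \text{ is derivable from }\Gamma\text{ by exactly one inference step}\}$, with $T^0(\Gamma)=\Gamma$, $T^{n+1}(\Gamma)=T(T^n(\Gamma))$. It is assumed that: $T$ is monotone; for finite $\Gamma$, $T(\Gamma)$ is finite and effectively computable; $\mathrm{Cn}(\Gamma)=\bigcup_{n\ge0}T^n(\Gamma)$ for finite $\Gamma$; and for finite $\Gamma$ the chain $T^n(\Gamma)$ stabilizes after finitely many steps at $\mathrm{Cn}(\Gamma)$. Knowledge bases are finite subsets of $\mathbb S_O$, effectively listable in a fixed canonical order, and the predicate $s\in\mathrm{Cn}(\Gamma)$ is decidable for finite $\Gamma\subseteq S_O$, $s\in S_O$. $\mathrm{Atom}(S_O)$ (irredundant core) is the output of: initialize $A\gets S_O$; scan the elements $s$ of $S_O$ in the canonical order and, if $s\in\mathrm{Cn}(A\setminus\{s\})$, set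 $A\gets A\setminus\{s\}$; output $A$. For finite $B\subseteq\mathbb S_O$ and $s\in\mathbb S_O$, the derivation depth is $\mathrm{Dd}(s\mid B):=\min\{n\ge0: s\in T^n(B)\}$, and $\mathrm{Dd}(s\mid B):=\infty$ if $s\notin\mathrm{Cn}(B)$. An information model consists of a semantic state set $S_O$, a carrier state set $S_C$ (finite sets of object–time states) and an enabling relation; it is ideal if there is a definable, time-order-preserving bijection $\tau:S_O\to S_C$ (a synonymy witness) and the enabling map is singleton-valued, $\mathcal E(s)=\{\tau(s)\}$; then $S_O$ is taken as its canonical semantic representative. *)

(* Defs.v *)
(* Built on MathComp: finmap for finite sets, classical_sets for arbitrary
   sets, [\bar int] for derivation depths (values in N u {oo}). *)
From HB Require Import structures.
From mathcomp Require Import all_boot all_order all_algebra finmap.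
From mathcomp Require Import all_classical all_reals.
Set Implicit Arguments.
Unset Strict Implicit.
Unset Printing Implicit Defensive.
Import Order.TTheory.
Local Open Scope classical_set_scope.

Inductive murec : Type :=
| MZero
| MSucc
| MProj of nat
| MComp of murec & seq murec
| MPrec of murec & murec
| MMin of murec.

(* [murec_eval p xs y]: the partial recursive function denoted by [p] is
   defined at [xs], with value [y].  The recursion argument of [MPrec] and the
   searched argument of [MMin] come first. *)
Inductive murec_eval : murec -> seq nat -> nat -> Prop :=
| EZero xs : murec_eval MZero xs 0
| ESucc x : murec_eval MSucc [:: x] x.+1
| EProj i xs : i < size xs -> murec_eval (MProj i) xs (nth 0 xs i)
| EComp f gs xs ys z :
    size ys = size gs ->
    (forall i, i < size gs -> murec_eval (nth MZero gs i) xs (nth 0 ys i)) ->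
    murec_eval f ys z ->
    murec_eval (MComp f gs) xs z
| EPrec0 f g xs y :
    murec_eval f xs y -> murec_eval (MPrec f g) (0 :: xs) y
| EPrecS f g n xs r y :
    murec_eval (MPrec f g) (n :: xs) r ->
    murec_eval g [:: n, r & xs] y ->
    murec_eval (MPrec f g) (n.+1 :: xs) y
| EMin f xs n (v : nat -> nat) :
    (forall m, m < n -> murec_eval f (m :: xs) (v m).+1) ->
    murec_eval f (n :: xs) 0 ->
    murec_eval (MMin f) xs n.

Lemma murec_eval_det p xs y z :
  murec_eval p xs y -> murec_eval p xs z -> y = z.
Proof.
move=> H; elim: H z => {p xs y}.
- by move=> xs z H; inversion H.
- by move=> x z H; inversion H.
- by move=> i xs _ z H; inversion H.
- move=> f gs xs ys z sz _ IHg _ IHf z' H.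
  inversion H as [| | |f0 gs0 xs0 ys0 z0 sz0 Hgs Hf| | |]; subst.
  have E : ys = ys0.
    apply: (@eq_from_nth _ 0); first by rewrite sz.
    by move=> i; rewrite sz => ltis; apply: IHg => //; apply: Hgs.
  by subst; apply: IHf.
- by move=> f g xs y _ IH z H; inversion H; subst; apply: IH.
- move=> f g n xs r y _ IHr _ IHy z H.
  inversion H as [| | | | |f0 g0 n0 xs0 r0 y0 Hr Hy|]; subst.
  by have E := IHr _ Hr; subst; apply: IHy.
- move=> f xs n v _ IHv _ IH0 m H.
  inversion H as [| | | | | |f0 xs0 n0 v0 Hv H0]; subst.
  case: (ltngtP n m) => // lt.
  + by have := IH0 _ (Hv _ lt).
  + by have := IHv _ lt _ H0.
Qed.

(* Elements of a countable type are coded by [choice.pickle] (finmap shadows the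
   short name), and a finite set by its canonical index. *)
Definition code_fset (S : countType) (G : {fset S}) : nat :=
  (\sum_(s <- enum_fset G) 2 ^ choice.pickle s)%N.

Definition code_seq (S : countType) (d : seq S) : nat :=
  CodeSeq.code [seq choice.pickle s | s <- d].

Section Inference.
Variables (S : countType) (infer : {fset S} -> S -> Prop).
Implicit Types (G : set S) (B : {fset S}) (s : S) (d : seq S).

(* [infer P s]: some rule of the proof system yields [s] in one application,
   from exactly the premises [P]. *)
Definition is_proof G d : Prop :=
  forall d1 s d2, d = d1 ++ s :: d2 ->
    G s \/ exists2 P : {fset S}, {subset P <= d1} & infer P s.

Definition Cn G : set S := [set s | exists d, is_proof G (rcons d s)].

Definition Tstep G : set S :=
  G `|` [set s | exists2 P : {fset S}, [set` P] `<=` G & infer P s].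

Lemma T_mono G G' : G `<=` G' -> Tstep G `<=` Tstep G'.
Proof.
move=> sGG' s [/sGG'|[P sPG Ps]]; first by left.
by right; exists P => //; apply: subset_trans sGG'.
Qed.

Lemma iterT_le G m n : m <= n -> iter m Tstep G `<=` iter n Tstep G.
Proof.
elim: n => [|n IHn]; first by rewrite leqn0 => /eqP->.
rewrite leq_eqVlt => /predU1P[-> //|]; rewrite ltnS => /IHn sub s /sub /=.
by left.
Qed.

Lemma is_proof_prefix G d1 d2 : is_proof G (d1 ++ d2) -> is_proof G d1.
Proof.
move=> pf e1 s e2 E; apply: (pf e1 s (e2 ++ d2)).
by rewrite E -catA.
Qed.

Lemma is_proof_rcons G d s : is_proof G d ->
  G s \/ (exists2 P : {fset S}, {subset P <= d} & infer P s) ->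
  is_proof G (rcons d s).
Proof.
move=> pf Hs e1 t e2; elim/last_ind: e2 => [|e2 u _].
  by rewrite cats1 => /rcons_inj[<- <-].
by rewrite -rcons_cons -rcons_cat => /rcons_inj[E _]; apply: pf E.
Qed.

Lemma is_proof_cat G d1 d2 :
  is_proof G d1 -> is_proof G d2 -> is_proof G (d1 ++ d2).
Proof.
move=> pf1; elim/last_ind: d2 => [|d2 s IH] pf2; first by rewrite cats0.
rewrite -rcons_cat; apply: is_proof_rcons.
  by apply: IH; apply: (@is_proof_prefix _ _ [:: s]); rewrite cats1.
have := pf2 d2 s [::]; rewrite cats1 => /(_ erefl)[|[P sP Ps]]; first by left.
by right; exists P => // x /sP; rewrite mem_cat orbC => ->.
Qed.

Lemma is_proof_mem G d s : is_proof G d -> s \in d -> Cn G s.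
Proof.
move=> pf /path.splitPr sd; case: sd pf => d1 d2 pf; exists d1.
by apply: (@is_proof_prefix _ _ d2); rewrite cat_rcons.
Qed.

Lemma is_proof_iterT G d s : is_proof G d -> s \in d -> iter (size d) Tstep G s.
Proof.
elim/last_ind: d s => [//|d u IH] s pf.
have pfd : is_proof G d by apply: (@is_proof_prefix _ _ [:: u]); rewrite cats1.
rewrite mem_rcons inE size_rcons => /predU1P[->|sd]; last by left; apply: IH.
have := pf d u [::]; rewrite cats1 => /(_ erefl)[Gu|[P sP Pu]].
  exact: (@iterT_le _ 0).
by right; exists P => // x /= /sP; apply: IH.
Qed.

Lemma Cn_premises G (P : seq S) : (forall x, x \in P -> Cn G x) ->
  exists2 d, is_proof G d & {subset P <= d}.
Proof.
elim: P => [|x P IH] H; first by exists [::] => // -[].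
have [y yP|d pf sP] := IH; first by apply: H; rewrite inE yP orbT.
have [e pfe] := H x (mem_head _ _).
exists (rcons e x ++ d); first exact: is_proof_cat.
move=> y; rewrite inE mem_cat mem_rcons inE => /predU1P[->|/sP->].
  by rewrite eqxx.
by rewrite orbT.
Qed.

Lemma T_Cn G : Tstep (Cn G) `<=` Cn G.
Proof.
move=> s [//|[P sP Ps]].
have [d pf sPd] := Cn_premises sP.
by exists d; apply: is_proof_rcons => //; right; exists P.
Qed.

Lemma Cn_refl G : G `<=` Cn G.
Proof.
by move=> s Gs; exists [::]; apply: (@is_proof_rcons _ [::]); [case|left].
Qed.

Lemma Cn_mono G G' : G `<=` G' -> Cn G `<=` Cn G'.
Proof.
move=> sGG' s [d pf]; exists d => d1 t d2 /pf[/sGG'|]; first by left.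
by right.
Qed.

Lemma Cn_iterT G : Cn G = \bigcup_n iter n Tstep G.
Proof.
apply/seteqP; split=> s.
  move=> [d pf]; exists (size (rcons d s)) => //.
  by apply: is_proof_iterT => //; rewrite mem_rcons mem_head.
move=> [n _]; elim: n s => [|n IH] s; first exact: Cn_refl.
by move=> /(T_mono IH)/T_Cn.
Qed.

Lemma Cn_idem G : Cn (Cn G) = Cn G.
Proof.
apply/seteqP; split; last exact: Cn_refl.
rewrite [X in X `<=` _]Cn_iterT => s [n _]; elim: n s => [//|n IH] s.
by move=> /(T_mono IH)/T_Cn.
Qed.

Lemma Cn_ex_iterT B s :
  Cn [set` B] s -> exists n, `[< iter n Tstep [set` B] s >].
Proof. by rewrite Cn_iterT => -[n _ H]; exists n; apply/asboolP. Qed.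

Definition Dd s B : \bar int :=
  match pselect (Cn [set` B] s) with
  | left h => (Posz (ex_minn (Cn_ex_iterT h)))%:E
  | right _ => +oo%E
  end.

Variable ord : rel S.

Definition canonical_order : Prop :=
  [/\ antisymmetric ord, transitive ord & total ord].

Definition canonical_listing B : seq S := sort ord (enum_fset B).

Definition scan_step B s : {fset S} :=
  if `[< Cn [set` (B `\ s)%fset] s >] then (B `\ s)%fset else B.

Definition Atom B : {fset S} := foldl scan_step B (canonical_listing B).

Definition proof_checking_decidable : Prop :=
  exists p, forall B d,
    murec_eval p [:: code_fset B; code_seq d] `[< is_proof [set` B] d >].

Definition Cn_decidable : Prop :=
  exists p, forall B s,
    murec_eval p [:: code_fset B; choice.pickle s] `[< Cn [set` B] s >].

Definition T_effective : Prop :=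
  exists p, forall B, exists2 B' : {fset S},
    [set` B'] = Tstep [set` B] & murec_eval p [:: code_fset B] (code_fset B').

Definition T_stabilizes : Prop :=
  forall B, exists N, forall n, N <= n ->
    iter n Tstep [set` B] = Cn [set` B].

Definition effectively_listable : Prop :=
  exists p, forall B,
    murec_eval p [:: code_fset B] (code_seq (canonical_listing B)).

End Inference.

(* Makes the elements of [X] object-time states: each is a state of an object
   at an instant.  Objects and time scales of the two sides of a model may
   differ. *)
Record ot_structure (X : Type) := OTStructure {
  ot_object : Type;
  ot_disp : Order.disp_t;
  ot_time : orderType ot_disp;
  object_of : X -> ot_object;
  time_of : X -> ot_time
}.

Record information_model (S C : choiceType) := InformationModel {
  sem_states : {fset S};
  car_states : {fset C};
  enables : set (S * C);
  enables_sub : enables `<=` [set` sem_states] `*` [set` car_states]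
}.

Section Models.
Variables (S : countType) (C : choiceType).
Variables (semO : ot_structure S) (carO : ot_structure C).

(* The class of relations between semantic and carrier states that count as
   definable is a parameter. *)
Variable definable : set (set (S * C)).
Implicit Type M : information_model S C.

Definition enabling_map M (s : S) : set C := [set c | enables M (s, c)].

Definition synonymy_witness M (tau : S -> C) : Prop :=
  [/\ set_bij [set` sem_states M] [set` car_states M] tau,
      {in sem_states M &, forall s s',
        (time_of semO s <= time_of semO s')%O ->
        (time_of carO (tau s) <= time_of carO (tau s'))%O} &
      definable [set p | p.1 \in sem_states M /\ p.2 = tau p.1]].

Definition ideal M : Prop :=
  exists2 tau, synonymy_witness M tau &
    forall s, s \in sem_states M -> enabling_map M s = [set tau s].

Variables (infer : {fset S} -> S -> Prop) (ord : rel S).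

Definition semantic_atomicity M : nat := #|` Atom infer ord (sem_states M)|.

Definition n_int M (q : S) : \bar int :=
  Dd infer q (Atom infer ord (sem_states M)).

Definition n_op M (q : S) : \bar int := Dd infer q (sem_states M).

(* The values are nonnegative, so the unit 0 only matters on the empty set. *)
Definition max_depth M : \bar int :=
  \big[maxe/0%E]_(q <- enum_fset (sem_states M)) n_int M q.

End Models.

(* Main.v *)
Require Import Defs.
From HB Require Import structures.
From mathcomp Require Import all_boot all_order all_algebra finmap.
From mathcomp Require Import all_classical all_reals.
Set Implicit Arguments.
Unset Strict Implicit.
Unset Printing Implicit Defensive.
Import Order.TTheory.
Local Open Scope classical_set_scope.

(* Write A for Atom(S_O).  Dropping s from A when s is in Cn(A \ s) does not
   change Cn(A), so S_O is included in Cn(A); hence every depth is finite, and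
   the maximal depth is the least n with S_O included in T^n(A).
   For computability, a set is coded by the sum of the 2^k over the codes k of
   its elements, so that membership is a bit test and removal a subtraction.
   The scan is a primitive recursion along the canonical listing of S_O, |A| is
   read off as the length of the canonical listing of A, and the maximal depth
   is found by minimization. *)

(** * Evaluation rules for composition, recursion and minimization *)

Lemma eval_comp1 f g xs y z :
  murec_eval g xs y -> murec_eval f [:: y] z ->
  murec_eval (MComp f [:: g]) xs z.
Proof. by move=> Hg; apply: EComp => // -[]. Qed.

Lemma eval_comp2 f g1 g2 xs y1 y2 z :
  murec_eval g1 xs y1 -> murec_eval g2 xs y2 -> murec_eval f [:: y1; y2] z ->
  murec_eval (MComp f [:: g1; g2]) xs z.
Proof. by move=> H1 H2; apply: EComp => // -[|[]]. Qed.

Lemma eval_comp3 f g1 g2 g3 xs y1 y2 y3 z :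
  murec_eval g1 xs y1 -> murec_eval g2 xs y2 -> murec_eval g3 xs y3 ->
  murec_eval f [:: y1; y2; y3] z ->
  murec_eval (MComp f [:: g1; g2; g3]) xs z.
Proof. by move=> H1 H2 H3; apply: EComp => // -[|[|[]]]. Qed.

(** The step is required only below [n], so that [g] may be undefined past the end of a list being
    traversed. *)
Lemma eval_prec (F : nat -> nat) f g n xs :
  murec_eval f xs (F 0) ->
  (forall i, i < n -> murec_eval g [:: i, F i & xs] (F i.+1)) ->
  murec_eval (MPrec f g) (n :: xs) (F n).
Proof.
move=> H0; elim: n => [_|n IH HS]; first exact: EPrec0.
by apply: EPrecS (HS _ _) => //; apply: IH => i /ltnW; apply: HS.
Qed.

Lemma eval_min (F : nat -> nat) f n xs :
  (forall i, i <= n -> murec_eval f (i :: xs) (F i)) ->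
  (forall i, i < n -> 0 < F i) -> F n = 0 ->
  murec_eval (MMin f) xs n.
Proof.
(* [EMin] expects the values before [n] in successor form, hence the predecessor. *)
move=> HF pos Fn; apply: (@EMin _ _ _ (fun i => (F i).-1)) => [i lt_in|].
  by rewrite prednK ?pos //; apply/HF/ltnW.
by rewrite -Fn; apply: HF.
Qed.

(** * Programs for elementary arithmetic and tests *)

Definition m_pred := MPrec MZero (MProj 0).

Lemma eval_pred n : murec_eval m_pred [:: n] n.-1.
Proof.
apply: (@eval_prec predn) => [|i _]; first exact: EZero.
exact: (@EProj 0).
Qed.

Definition m_add := MPrec (MProj 0) (MComp MSucc [:: MProj 1]).

Lemma eval_add m n : murec_eval m_add [:: m; n] (m + n).
Proof.
apply: (@eval_prec (addn^~ n)) => [|i _]; first exact: (@EProj 0).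
by apply: eval_comp1; [exact: (@EProj 1)|exact: ESucc].
Qed.

(** The recursion runs on the subtrahend, so the arguments are swapped to bring it first. *)
Definition m_sub :=
  MComp (MPrec (MProj 0) (MComp m_pred [:: MProj 1])) [:: MProj 1; MProj 0].

Lemma eval_sub m n : murec_eval m_sub [:: m; n] (m - n).
Proof.
apply: eval_comp2; [exact: (@EProj 1)|exact: (@EProj 0)|].
apply: (@eval_prec (subn m)) => [|i _].
  by rewrite subn0; exact: (@EProj 0).
by apply: eval_comp1; [exact: (@EProj 1)|rewrite subnS; exact: eval_pred].
Qed.

Definition m_is0 := MPrec (MComp MSucc [:: MZero]) MZero.

Lemma eval_is0 n : murec_eval m_is0 [:: n] (n == 0).
Proof.
apply: (@eval_prec (fun n => n == 0)) => [|i _]; last exact: EZero.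
by apply: eval_comp1; [exact: EZero|exact: ESucc].
Qed.

(** Recursion serves as a case distinction on 0 or 1: the base case sees [[:: m; n]], while the step
    sees two more arguments in front, so that index 2 is [m]. *)
Definition m_if := MPrec (MProj 1) (MProj 2).

Lemma eval_if (b : bool) m n :
  murec_eval m_if [:: nat_of_bool b; m; n] (if b then m else n).
Proof.
have := @eval_prec (fun k => if k == 0 then n else m) (MProj 1) (MProj 2) b [:: m; n].
by case: b => /=; apply => [|i _]; (exact: (@EProj 1) || exact: (@EProj 2)).
Qed.

Definition m_exp2 :=
  MPrec (MComp MSucc [:: MZero]) (MComp m_add [:: MProj 1; MProj 1]).

Lemma eval_exp2 n : murec_eval m_exp2 [:: n] (2 ^ n).
Proof.
apply: (@eval_prec (expn 2)) => [|i _].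
  by apply: eval_comp1; [exact: EZero|exact: ESucc].
rewrite expnS mul2n -addnn.
by apply: eval_comp2; [exact: (@EProj 1)|exact: (@EProj 1)|exact: eval_add].
Qed.

Definition m_odd := MPrec MZero (MComp m_is0 [:: MProj 1]).

Lemma eval_odd n : murec_eval m_odd [:: n] (odd n).
Proof.
apply: (@eval_prec odd) => [|i _]; first exact: EZero.
apply: eval_comp1; first exact: (@EProj 1).
by have := eval_is0 (odd i); rewrite eqb0.
Qed.

Definition m_half :=
  MPrec MZero (MComp m_add [:: MComp m_odd [:: MProj 0]; MProj 1]).

Lemma eval_half n : murec_eval m_half [:: n] n./2.
Proof.
apply: (@eval_prec half) => [|i _]; first exact: EZero.
rewrite -[i.+1./2]/(uphalf i) uphalf_half.
apply: eval_comp2; [|exact: (@EProj 1)|exact: eval_add].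
by apply: eval_comp1; [exact: (@EProj 0)|exact: eval_odd].
Qed.

(** * Binary digits and decoding of lists *)

Definition bit k n := odd (iter k half n).

Definition m_shift := MPrec (MProj 0) (MComp m_half [:: MProj 1]).

Lemma eval_shift k n : murec_eval m_shift [:: k; n] (iter k half n).
Proof.
apply: (@eval_prec (fun k => iter k half n)) => [|i _]; first exact: (@EProj 0).
by apply: eval_comp1; [exact: (@EProj 1)|exact: eval_half].
Qed.

Definition m_bit := MComp m_odd [:: m_shift].

Lemma eval_bit k n : murec_eval m_bit [:: k; n] (bit k n).
Proof. by apply: eval_comp1; [exact: eval_shift|exact: eval_odd]. Qed.

(** The code of [n :: s] is [2 ^ n] times an odd number: the head is the position of the lowest set
    bit, and shifting that bit out leaves the code of the tail. Only the empty list has code 0, so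
    the length is the least number of tails that gives 0. *)
Definition m_head := MMin (MComp m_is0 [:: m_bit]).
Definition m_tail := MComp m_half [:: MComp m_shift [:: m_head; MProj 0]].
Definition m_drop := MPrec (MProj 0) (MComp m_tail [:: MProj 1]).
Definition m_size := MMin m_drop.
Definition m_nth := MComp m_head [:: m_drop].

Lemma iter_half_exp2 k n : iter k half (2 ^ k * n) = n.
Proof.
by elim: k => [|k IH]; rewrite ?mul1n // iterSr expnS -mulnA mul2n doubleK.
Qed.

Lemma code_cons n s : CodeSeq.code (n :: s) = 2 ^ n * (CodeSeq.code s).*2.+1.
Proof. by []. Qed.

Lemma eval_head n s : murec_eval m_head [:: CodeSeq.code (n :: s)] n.
Proof.
rewrite code_cons; set c := _ * _.
apply: (@eval_min (fun i => nat_of_bool (nat_of_bool (bit i c) == 0))).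
- by move=> i _; apply: eval_comp1; [exact: eval_bit|exact: eval_is0].
(* For [i < n], a shift by [i] leaves a factor 2, so this bit is 0. *)
- move=> i lt_in; rewrite eqb0 lt0b /bit /c -(subnKC lt_in) addSnnS expnD -mulnA.
  by rewrite iter_half_exp2 expnS -mulnA mul2n odd_double.
- by rewrite /bit /c iter_half_exp2 /= odd_double.
Qed.

Lemma eval_tail n s :
  murec_eval m_tail [:: CodeSeq.code (n :: s)] (CodeSeq.code s).
Proof.
apply: eval_comp1.
  by apply: eval_comp2; [exact: eval_head|exact: (@EProj 0)|exact: eval_shift].
rewrite code_cons iter_half_exp2.
by have := eval_half (CodeSeq.code s).*2.+1; rewrite /= uphalf_double.
Qed.

(** The bound matters: [m_tail] diverges on the code 0 of the empty list, which has no set bit to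
    find. *)
Lemma eval_drop i s : i <= size s ->
  murec_eval m_drop [:: i; CodeSeq.code s] (CodeSeq.code (drop i s)).
Proof.
move=> le_is; apply: (@eval_prec (fun i => CodeSeq.code (drop i s))) => [|j lt_ji].
  by rewrite drop0; exact: (@EProj 0).
apply: eval_comp1; first exact: (@EProj 1).
by rewrite (drop_nth 0 (leq_trans lt_ji le_is)); exact: eval_tail.
Qed.

Lemma eval_size s : murec_eval m_size [:: CodeSeq.code s] (size s).
Proof.
apply: (@eval_min (fun i => CodeSeq.code (drop i s))) => [i|i lt_is|].
- exact: eval_drop.
- by rewrite (drop_nth 0 lt_is) code_cons muln_gt0 expn_gt0.
- by rewrite drop_size.
Qed.

Lemma eval_nth i s : i < size s ->
  murec_eval m_nth [:: i; CodeSeq.code s] (nth 0 s i).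
Proof.
move=> lt_is; apply: eval_comp1; first exact: eval_drop (ltnW lt_is).
by rewrite (drop_nth 0 lt_is); exact: eval_head.
Qed.

(** * Bits of a sum of distinct powers of two *)

Lemma sum_exp2_half (l : seq nat) : uniq l ->
  (\sum_(i <- l) 2 ^ i =
   (0 \in l) + (\sum_(i <- [seq i.-1 | i <- l & 0 < i]) 2 ^ i).*2)%N.
Proof.
elim: l => [|i l IH]; first by rewrite !big_nil.
rewrite cons_uniq => /andP[il /IH{}IH]; rewrite big_cons IH inE.
case: i il => [|i] il /=; first by rewrite (negbTE il).
by rewrite big_cons doubleD expnS mul2n addnCA.
Qed.

(** Halving drops the exponent 0 and lowers the others by one, and the lowered exponents are still
    distinct; hence induction on [k]. *)
Lemma bit_sum_exp2 k (l : seq nat) :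
  uniq l -> bit k (\sum_(i <- l) 2 ^ i)%N = (k \in l).
Proof.
elim: k l => [|k IH] l Ul; rewrite /bit sum_exp2_half //.
  by rewrite /= oddD odd_double addbF oddb.
rewrite iterSr half_bit_double -/(bit k _) IH; last first.
  rewrite map_inj_in_uniq ?filter_uniq // => i j.
  by rewrite !mem_filter; case: i => [|i] //; case: j => [|j] //= _ _ ->.
apply/mapP/idP => [[[|i]]|kl].
- by rewrite mem_filter.
- by rewrite mem_filter /= => il ->.
- by exists k.+1; rewrite // mem_filter.
Qed.

(** * Codes and canonical listings of knowledge bases *)

Section Knowledge_bases.
Variables (S : countType) (infer : {fset S} -> S -> Prop) (ord : rel S).
Implicit Types (B A X : {fset S}) (s q : S).

Lemma bit_code_fset B s : bit (choice.pickle s) (code_fset B) = (s \in B).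
Proof.
rewrite /code_fset -[X in bit _ X](big_map choice.pickle xpredT (expn 2)).
rewrite bit_sum_exp2 ?mem_map ?map_inj_uniq ?fset_uniq //;
  exact: pcan_inj choice.pickleK.
Qed.

Lemma code_fsetD1 B s : s \in B ->
  code_fset (B `\ s)%fset = code_fset B - 2 ^ choice.pickle s.
Proof.
move=> sB; have perm_B : perm_eq (enum_fset B) (s :: enum_fset (B `\ s)%fset).
  apply: uniq_perm => [||x]; first exact: fset_uniq.
    by rewrite /= fset_uniq andbT !inE eqxx.
  by rewrite in_cons in_fsetD1; case: eqVneq => [->|].
by rewrite /code_fset (perm_big _ perm_B) big_cons addKn.
Qed.

Lemma canonical_listing_uniq B : uniq (canonical_listing ord B).
Proof. by rewrite sort_uniq fset_uniq. Qed.

Lemma mem_canonical_listing B : canonical_listing ord B =i B.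
Proof. by move=> s; rewrite mem_sort. Qed.

(** * The scan and the irredundant core *)

Lemma foldl_scan_step_sub (l : seq S) B :
  {subset foldl (scan_step infer) B l <= B}.
Proof.
elim: l B => [|s l IH] B q //= /IH; rewrite /scan_step.
by case: ifP => // _; rewrite in_fsetD1 => /andP[].
Qed.

(** Ensures that an element about to be scanned is still present, so that its removal is a
    subtraction of codes. *)
Lemma foldl_scan_step_keep (l : seq S) B q :
  q \in B -> q \notin l -> q \in foldl (scan_step infer) B l.
Proof.
elim: l B => [|s l IH] B //= qB; rewrite inE negb_or => /andP[qs]; apply: IH.
by rewrite /scan_step; case: ifP => // _; rewrite in_fsetD1 qs.
Qed.

Lemma Cn_foldl_scan_step (l : seq S) B :
  Cn infer [set` foldl (scan_step infer) B l] = Cn infer [set` B].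
Proof.
elim: l B => [|s l IH] B //=; rewrite {}IH /scan_step.
case: ifP => // /asboolP sB; apply/seteqP; split.
  by apply: Cn_mono => q; rewrite /= in_fsetD1 => /andP[].
(* By idempotence it is enough to derive each element of [B] from [B] without [s]: [s] by the test,
   the others by reflexivity. *)
rewrite -[X in _ `<=` X]Cn_idem; apply: Cn_mono => q /= qB.
have [->//|qs] := eqVneq q s.
by apply: Cn_refl; rewrite /= in_fsetD1 qs.
Qed.

Lemma Atom_sub B : {subset Atom infer ord B <= B}.
Proof. exact: foldl_scan_step_sub. Qed.

Lemma Cn_Atom B : Cn infer [set` Atom infer ord B] = Cn infer [set` B].
Proof. exact: Cn_foldl_scan_step. Qed.

(** Both listings of [B] are sorted for [ord] and are permutations of each other, so antisymmetry
    and transitivity make them equal. *)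
Lemma eq_Atom (ord' : rel S) B :
  canonical_order ord -> canonical_order ord' -> {in B &, ord' =2 ord} ->
  Atom infer ord' B = Atom infer ord B.
Proof.
move=> [anti trans tot] [_ _ tot'] E.
rewrite /Atom; congr foldl; apply: (sorted_eq trans anti).
- have: sorted ord' (sort ord' (enum_fset B)) by apply: sort_sorted.
  apply: (@sub_in_sorted _ (mem B)) => [x y xB yB|]; first by rewrite E.
  by apply/allP => x; rewrite mem_sort.
- exact: sort_sorted.
- by rewrite perm_sort perm_sym perm_sort.
Qed.

(** * Depth bounds as membership in iterates of [Tstep] *)

Lemma Dd_le q B n :
  (Dd infer q B <= (Posz n)%:E)%E <-> iter n (Tstep infer) [set` B] q.
Proof.
rewrite /Dd; case: pselect => [h|nh].
  rewrite lee_fin lez_nat; case: ex_minnP => m /asboolP mq min; split.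
    by move=> le_mn; apply: iterT_le mq.
  by move=> nq; apply: min; apply/asboolP.
(* Infinite depth: no iterate contains [q], since all of them lie in [Cn]. *)
by split=> // nq; case: nh; rewrite Cn_iterT; exists n.
Qed.

Lemma Dd_fin q B : Cn infer [set` B] q ->
  exists n, Dd infer q B = (Posz n)%:E.
Proof. by rewrite /Dd; case: pselect => // h _; eexists. Qed.

Lemma iterT_mono n (G G' : set S) : G `<=` G' ->
  iter n (Tstep infer) G `<=` iter n (Tstep infer) G'.
Proof. by move=> sGG'; elim: n => //= n IH; apply: T_mono. Qed.

Lemma Dd_anti q B B' : {subset B <= B'} -> (Dd infer q B' <= Dd infer q B)%E.
Proof.
move=> sBB'; have [/Dd_fin[n E]|nq] := pselect (Cn infer [set` B] q).
  rewrite E; apply/Dd_le; apply: (@iterT_mono _ [set` B]) => //.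
  by apply/Dd_le; rewrite E.
by rewrite [leRHS]/Dd; case: pselect => // _; rewrite leey.
Qed.

(** * Programs for the iterates, the core and the maximal depth *)

Lemma iterT_fset p B :
  (forall B, exists2 B', [set` B'] = Tstep infer [set` B] &
     murec_eval p [:: code_fset B] (code_fset B')) ->
  exists X : nat -> {fset S}, forall n,
    [set` X n] = iter n (Tstep infer) [set` B] /\
    murec_eval (MPrec (MProj 0) (MComp p [:: MProj 1]))
      [:: n; code_fset B] (code_fset (X n)).
Proof.
(* The finite stages are built one at a time by induction; choice collects them into one
   sequence. *)
move=> Tp; suff /choice[X HX] : forall n, exists X,
    [set` X] = iter n (Tstep infer) [set` B] /\
    murec_eval (MPrec (MProj 0) (MComp p [:: MProj 1]))
      [:: n; code_fset B] (code_fset X) by exists X.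
elim=> [|n [X [XE IH]]].
  by exists B; split=> //; apply: EPrec0; exact: (@EProj 0).
have [X' X'E HX] := Tp X; exists X'; split; first by rewrite X'E XE.
by apply: EPrecS IH _; apply: eval_comp1 HX; exact: (@EProj 1).
Qed.

(* Arguments: a number of list elements to test, the code of the set, the code
   of the list. *)
Definition m_missing :=
  MPrec MZero (MComp m_add
    [:: MProj 1;
        MComp m_is0 [:: MComp m_bit [:: MComp m_nth [:: MProj 0; MProj 3];
                                        MProj 2]]]).

Lemma eval_missing (l : seq S) X :
  murec_eval m_missing [:: size l; code_fset X; code_seq l]
    (count (fun s => s \notin X) l).
Proof.
(* Writing [l] as [take (size l) l] exposes the recursion on prefixes. *)
rewrite -[count _ l](congr1 (count _) (take_size l)).
apply: (@eval_prec (fun i => count (fun s => s \notin X) (take i l))) => [|i lt_il].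
  by rewrite take0; exact: EZero.
(* [S] may be empty; the default for [nth] comes from the nonempty list. *)
have [s0 _] : exists s0 : S, True by case: l lt_il => // s0; exists s0.
rewrite (take_nth s0) // -cats1 count_cat /= addn0.
apply: eval_comp2; [exact: (@EProj 1)| |exact: eval_add].
apply: eval_comp1.
  apply: eval_comp2; [|exact: (@EProj 2)|exact: eval_bit].
  apply: eval_comp2; [exact: (@EProj 0)|exact: (@EProj 3)|].
  by apply: eval_nth; rewrite size_map.
rewrite (nth_map s0) // bit_code_fset.
by have := eval_is0 (nth s0 l i \in X); rewrite eqb0.
Qed.

(* Arguments: a number of list elements to scan, the code of the initial set,
   the code of the list.  Both branches of [m_if] are evaluated, which is
   harmless since [pC] is only ever run on codes of actual sets. *)
Definition m_scan pC :=
  MPrec (MProj 0)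
    (let s := MComp m_nth [:: MProj 0; MProj 3] in
     let As := MComp m_sub [:: MProj 1; MComp m_exp2 [:: s]] in
     MComp m_if [:: MComp pC [:: As; s]; As; MProj 1]).

Lemma eval_scan pC B (l : seq S) :
  (forall B s,
    murec_eval pC [:: code_fset B; choice.pickle s] `[< Cn infer [set` B] s >]) ->
  uniq l -> {subset l <= B} ->
  murec_eval (m_scan pC) [:: size l; code_fset B; code_seq l]
    (code_fset (foldl (scan_step infer) B l)).
Proof.
move=> HC Ul lB; rewrite -{3}(take_size l).
apply: (@eval_prec (fun i => code_fset (foldl (scan_step infer) B (take i l))))
  => [|i lt_il].
  by rewrite take0; exact: (@EProj 0).
have [s0 _] : exists s0 : S, True by case: l lt_il {Ul lB} => // s0; exists s0.
rewrite (take_nth s0) // -cats1 foldl_cat /=.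
set s := nth s0 l i; set A := foldl _ B _.
(* By uniqueness of the listing, [s] does not occur in the prefix already scanned. *)
have sA : s \in A.
  apply: foldl_scan_step_keep; first exact/lB/mem_nth.
  by rewrite in_take ?mem_nth // index_uniq // ltnn.
have eval_s xs : nth 0 xs 0 = i -> nth 0 xs 3 = code_seq l -> 3 < size xs ->
    murec_eval (MComp m_nth [:: MProj 0; MProj 3]) xs (choice.pickle s).
  move=> x0 x3 sz; rewrite -(nth_map s0 0) //.
  apply: eval_comp2; first by apply: EProj; apply: leq_trans sz.
    exact: EProj.
  by rewrite x0 x3; apply: eval_nth; rewrite size_map.
rewrite /scan_step (fun_if (@code_fset S)).
have eval_As : murec_eval
    (MComp m_sub [:: MProj 1; MComp m_exp2 [:: MComp m_nth [:: MProj 0; MProj 3]]])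
    [:: i; code_fset A; code_fset B; code_seq l] (code_fset (A `\ s)%fset).
  rewrite code_fsetD1 //; apply: eval_comp2; last exact: eval_sub.
    exact: (@EProj 1).
  by apply: eval_comp1; [exact: eval_s|exact: eval_exp2].
apply: eval_comp3; [|exact: eval_As|exact: (@EProj 1)|exact: eval_if].
by apply: eval_comp2; [exact: eval_As|exact: eval_s|exact: HC].
Qed.

Definition m_atom pC pL :=
  MComp (m_scan pC) [:: MComp m_size [:: pL]; MProj 0; pL].

Lemma eval_atom pC pL B :
  (forall B s,
    murec_eval pC [:: code_fset B; choice.pickle s] `[< Cn infer [set` B] s >]) ->
  murec_eval pL [:: code_fset B] (code_seq (canonical_listing ord B)) ->
  murec_eval (m_atom pC pL) [:: code_fset B] (code_fset (Atom infer ord B)).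
Proof.
move=> HC HL; apply: eval_comp3; [|exact: (@EProj 0)|exact: HL|].
  by apply: eval_comp1; [exact: HL|exact: eval_size].
rewrite size_map; apply: eval_scan => // [|s]; first exact: canonical_listing_uniq.
by rewrite mem_canonical_listing.
Qed.

(** Under the minimization the arguments are the candidate depth, the code of the core and the code
    of the listing of the whole base; the search stops once no listed element is missing from the
    iterate. *)
Definition m_depth pC pL pT :=
  MComp
    (MMin (MComp m_missing
       [:: MComp m_size [:: MProj 2];
           MComp (MPrec (MProj 0) (MComp pT [:: MProj 1])) [:: MProj 0; MProj 1];
           MProj 2]))
    [:: m_atom pC pL; pL].

Lemma eval_depth pC pL pT B n :
  (forall B s,
    murec_eval pC [:: code_fset B; choice.pickle s] `[< Cn infer [set` B] s >]) ->
  murec_eval pL [:: code_fset B] (code_seq (canonical_listing ord B)) ->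
  (forall B, exists2 B', [set` B'] = Tstep infer [set` B] &
     murec_eval pT [:: code_fset B] (code_fset B')) ->
  (forall m, n <= m <->
    [set` B] `<=` iter m (Tstep infer) [set` Atom infer ord B]) ->
  murec_eval (m_depth pC pL pT) [:: code_fset B] n.
Proof.
move=> HC HL HT Hn; apply: eval_comp2; [exact: eval_atom|exact: HL|].
have [X HX] := iterT_fset (Atom infer ord B) HT.
set l := canonical_listing ord B.
(* Nothing is missing at stage [m] exactly when [n <= m], so the search returns [n]. *)
have lX m : (count (fun s => s \notin X m) l == 0) = (n <= m).
  rewrite -leqn0 leqNgt -has_count has_predC negbK.
  apply/allP/idP => [lX|/Hn BX s].
    apply/Hn => s /= sB; have [<- _] := HX m.
    by apply: lX; rewrite mem_canonical_listing.
  rewrite mem_canonical_listing => /BX.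
  by have [<- _] := HX m.
apply: (@eval_min (fun m => count (fun s => s \notin X m) l)).
- move=> m _; apply: eval_comp3; last exact: eval_missing.
  + apply: eval_comp1; first exact: (@EProj 2).
    by rewrite -(size_map choice.pickle l); exact: eval_size.
  + by apply: eval_comp2; [exact: (@EProj 0)|exact: (@EProj 1)|exact: (HX m).2].
  + exact: (@EProj 2).
- by move=> m; rewrite lt0n lX -ltnNge.
- by apply/eqP; rewrite lX.
Qed.

(** Turns the maximal depth into the covering condition that [m_depth] searches for; the unit 0 is
    below every natural bound. *)
Lemma max_Dd_le B A n :
  (\big[maxe/0%E]_(q <- enum_fset B) Dd infer q A <= (Posz n)%:E)%E <->
  [set` B] `<=` iter n (Tstep infer) [set` A].
Proof.
split=> [le_n q qB|BA].
  apply/Dd_le; apply: le_trans le_n.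
  exact: (le_bigmax_seq _ q xpredT (fun q => Dd infer q A) qB).
by rewrite big_seq; apply: bigmax_le => // q qB; apply/Dd_le/BA.
Qed.

Lemma max_Dd_fin B A : [set` B] `<=` Cn infer [set` A] ->
  exists n, \big[maxe/0%E]_(q <- enum_fset B) Dd infer q A = (Posz n)%:E.
Proof.
move=> BA; rewrite big_seq.
apply: (big_ind (fun x => exists n, x = (Posz n)%:E)).
- by exists 0.
- move=> _ _ [m ->] [n ->].
  by case: (leP (Posz m)%:E%E (Posz n)%:E%E) => _; [exists n|exists m].
- by move=> q /BA/Dd_fin.
Qed.

End Knowledge_bases.

Theorem theorem1 (S : countType) (semO : ot_structure S)
    (infer : {fset S} -> S -> Prop) (ord : rel S)
    (ps_effective : proof_checking_decidable infer)
    (Cn_dec : Cn_decidable infer)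
    (T_eff : T_effective infer)
    (T_stab : T_stabilizes infer)
    (ord_canonical : canonical_order ord)
    (kb_listable : effectively_listable ord) :
  exists pA pD : murec,
  forall (C : choiceType) (carO : ot_structure C)
    (definable : set (set (S * C))) (I : information_model S C),
  ideal semO carO definable I ->
  [/\ (* (i) *)
      forall (ord' : rel S) (C' : choiceType) (carO' : ot_structure C')
        (definable' : set (set (S * C'))) (I' : information_model S C'),
        ideal semO carO' definable' I' ->
        canonical_order ord' ->
        sem_states I' = sem_states I ->
        {in sem_states I &, ord' =2 ord} ->
        semantic_atomicity infer ord' I' = semantic_atomicity infer ord I /\
        max_depth infer ord' I' = max_depth infer ord I,
      (* (ii) *)
      murec_eval pA [:: code_fset (sem_states I)]
        (semantic_atomicity infer ord I) /\
      (exists2 n : nat,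
        max_depth infer ord I = (Posz n)%:E &
        murec_eval pD [:: code_fset (sem_states I)] n),
      (* (iii) *)
      forall q : S, q \in sem_states I ->
        (n_op infer I q <= n_int infer ord I q)%E /\
        (n_int infer ord I q <= max_depth infer ord I)%E &
      (* (iv) *)
      max_depth infer ord I = 0%E <->
        Atom infer ord (sem_states I) = sem_states I].

Proof.
have [pC HC] := Cn_dec; have [pT HT] := T_eff; have [pL HL] := kb_listable.
exists (MComp m_size [:: MComp pL [:: m_atom pC pL]]), (m_depth pC pL pT).
move=> C carO definable I _; set B := sem_states I.
have BA : [set` B] `<=` Cn infer [set` Atom infer ord B].
  by rewrite Cn_Atom; exact: Cn_refl.
have [n maxE] : exists n, max_depth infer ord I = (Posz n)%:E.
  exact: max_Dd_fin.
split.
- move=> ord' C' carO' definable' I' _ ord'_canonical BE E.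
  by rewrite /semantic_atomicity /max_depth /n_int BE (eq_Atom _ _ _ E).
- split; last first.
    exists n => //; apply: eval_depth => // m.
    rewrite -max_Dd_le -[X in (X <= _)%E]/(max_depth infer ord I) maxE.
    by rewrite lee_fin lez_nat.
  apply: eval_comp1.
    by apply: eval_comp1; [exact: eval_atom|exact: HL].
  have := eval_size
    [seq choice.pickle s | s <- canonical_listing ord (Atom infer ord B)].
  by rewrite size_map size_sort.
- move=> q qB; split; first by apply: Dd_anti; exact: Atom_sub.
  exact: (le_bigmax_seq _ q xpredT (n_int infer ord I) qB).
- split=> [max0|AB].
    apply/fsetP => q; apply/idP/idP => [|qB]; first exact: Atom_sub.
    (* The iterate at stage 0 is the core itself, so a bound 0 puts all of [B] into it. *)
    have /max_Dd_le : (max_depth infer ord I <= (Posz 0)%:E)%E by rewrite max0.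
    exact.
  apply/le_anti/andP; split; first by apply/(@max_Dd_le _ _ _ _ 0); rewrite AB.
  (* The maximum is a natural number, hence nonnegative. *)
  by rewrite maxE lee_fin.
Qed.
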